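(* Let $|||\cdot|||$ be a symmetric norm on $\mathcal{M}_n$, let $A,B\in\mathcal{P}_n$, $K\in\mathcal{M}_n$, and let $p,q,s\in\mathbb{R}$. Put $$\tilde\Psi_{p,q,s}(A,B)=\left|\left|\left|\left(B^{\frac q2}K^*A^pKB^{\frac q2}\right)^s\right|\right|\right|.$$ (i) If $s,q>0$ and $s<1/q$, then $$\tilde\Psi_{p,q,s}(A,B)=\min_{Z>0}\left\{\left|\left|\left|(Z^{-\frac12}K^*A^pKZ^{-\frac12})^{\frac{s}{1-sq}}\right|\right|\right|^{1-sq}\cdot\left|\left|\left|(Z^{\frac12}B^qZ^{\frac12})^{\frac1q}\right|\right|\right|^{sq}\right\}$$ and $$\tilde\Psi_{p,q,s}(A,B)=\min_{Z>0}\left\{(1-sq)\left|\left|\left|(Z^{-\frac12}K^*A^pKZ^{-\frac12})^{\frac{s}{1-sq}}\right|\right|\right|+sq\left|\left|\left|(Z^{\frac12}B^qZ^{\frac12})^{\frac1q}\right|\right|\right|\right\}.$$ (ii) If $s>0$ and $q<0$, then $$\tilde\Psi_{p,q,s}(A,B)=\max_{Z>0}\left\{\left|\left|\left|(Z^{-\frac12}K^*A^pKZ^{-\frac12})^{\frac{s}{1-sq}}\right|\right|\right|^{1-sq}\cdot\left|\left|\left|(Z^{\frac12}B^qZ^{\frac12})^{\frac1q}\right|\right|\right|^{sq}\right\}$$ and $$\tilde\Psi_{p,q,s}(A,B)=\max_{Z>0}\left\{(1-sq)\left|\left|\left|(Z^{-\frac12}K^*A^pKZ^{-\frac12})^{\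frac{s}{1-sq}}\right|\right|\right|+sq\left|\left|\left|(Z^{\frac12}B^qZ^{\frac12})^{\frac1q}\right|\right|\right|\right\}.$$
   Context: $\mathcal{M}_n$ is the set of $n\times n$ matrices and $\mathcal{P}_n$ the set of $n\times n$ positive definite matrices; $Z>0$ means $Z\in\mathcal{P}_n$. Powers of positive (semi)definite matrices are taken by functional calculus. A symmetric gauge function is a norm $\Phi$ on $\mathbb{R}^n$, invariant under permutations of coordinates and under sign changes of coordinates, with $\Phi(1,0,\ldots,0)=1$. A symmetric norm on $\mathcal{M}_n$ is a norm of the form $|||A|||=\Phi(s(A))$, where $\Phi$ is a symmetric gauge function and $s(A)=(s_1(A),\ldots,s_n(A))$ is the vector of singular values of $A$ in decreasing order.
   Formalization: For singular K the min/max need not be attained (e.g. n=1, K=0 in the second formulas), so the formulas are proved with infimum in (i) and supremum in (ii) for every K, and as a true minimum/maximum when K is invertible. *)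

(* Defs.v *)
From mathcomp Require Import all_boot all_order all_algebra perm.
From mathcomp Require Import complex.
From mathcomp Require Import boolp classical_sets reals exp.

Set Implicit Arguments.
Unset Strict Implicit.
Unset Printing Implicit Defensive.

Import Order.TTheory GRing.Theory Num.Theory.
Local Open Scope classical_set_scope.
Local Open Scope ring_scope.
Local Open Scope complex_scope.
Local Open Scope sesquilinear_scope.

Section Matrices.
Variables (R : realType) (n : nat).
Implicit Types (A B K X Z : 'M[R[i]]_n) (N : 'M[R[i]]_n -> R).

Definition posdefmx A : Prop :=
  A \is hermsymmx /\
  forall v : 'cV[R[i]]_n, v != 0 -> 0 < (v^t* *m A *m v) ord0 ord0.

(* The real power A^t by functional calculus: if A = U^* diag(d) U with U
   unitary, then A^t = U^* diag(d_i^t) U.  It is meaningful for A positive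
   definite, or A positive semidefinite and t > 0 (where 0^t = 0); outside of
   these cases [powR] returns conventional values. *)
Definition mxpow A (t : R) : 'M[R[i]]_n :=
  (spectralmx A)^t*
    *m diag_mx (\row_i ((complex.Re (spectral_diag A ord0 i)) `^ t)%:C)
    *m spectralmx A.

Definition singular_seq A : seq R :=
  [seq Num.sqrt (complex.Re (spectral_diag (A^t* *m A) ord0 i)) | i <- enum 'I_n].

(* (s_1(A), ..., s_n(A)) in decreasing order *)
Definition singular_values A : 'rV[R]_n :=
  \row_(i < n) nth 0 (sort (fun x y : R => y <= x) (singular_seq A)) i.

(* For n = 0 there is no symmetric gauge function: the zero row would have to
   have norm 1. *)
Definition symmetric_gauge (Phi : 'rV[R]_n -> R) : Prop :=
  [/\ [/\ forall x, 0 <= Phi x,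
          forall x, Phi x = 0 -> x = 0,
          forall (c : R) x, Phi (c *: x) = `|c| * Phi x
        & forall x y, Phi (x + y) <= Phi x + Phi y],
      forall (sigma : 'S_n) x, Phi (col_perm sigma x) = Phi x,
      forall (e : 'I_n -> bool) (x : 'rV[R]_n),
        Phi (\row_i ((-1) ^+ e i * x ord0 i)) = Phi x
    & Phi (\row_(i < n) (val i == 0%N)%:R) = 1].

Definition mxnorm N : Prop :=
  [/\ forall A, 0 <= N A,
      forall A, N A = 0 -> A = 0,
      forall (c : R[i]) A, N (c *: A) = complex.Re `|c| * N A
    & forall A B, N (A + B) <= N A + N B].

Definition symmetric_norm N : Prop :=
  mxnorm N /\
  exists Phi, symmetric_gauge Phi /\ forall A, N A = Phi (singular_values A).

Definition tPsi N K (p q s : R) A B : R :=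
  N (mxpow (mxpow B (q / 2) *m K^t* *m mxpow A p *m K *m mxpow B (q / 2)) s).

Definition left_term N K (p q s : R) A Z : R :=
  N (mxpow (mxpow Z (- (1 / 2)) *m K^t* *m mxpow A p *m K
              *m mxpow Z (- (1 / 2)))
           (s / (1 - s * q))).

Definition right_term N (q : R) B Z : R :=
  N (mxpow (mxpow Z (1 / 2) *m mxpow B q *m mxpow Z (1 / 2)) (1 / q)).

Definition prod_form N K (p q s : R) A B Z : R :=
  left_term N K p q s A Z `^ (1 - s * q) * right_term N q B Z `^ (s * q).

Definition sum_form N K (p q s : R) A B Z : R :=
  (1 - s * q) * left_term N K p q s A Z + s * q * right_term N q B Z.

End Matrices.

Definition is_min (R : realType) (S : set R) (m : R) : Prop :=
  S m /\ lbound S m.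

Definition is_max (R : realType) (S : set R) (m : R) : Prop :=
  S m /\ ubound S m.

(* For singular K the extremum over Z > 0 need not be attained: if n = 1 and
   K = 0, the infimum over z > 0 of s q (z b^q)^(1/q) is 0 but every value is
   positive.  Hence the extremum is the infimum (supremum) for every K, and a
   genuine minimum (maximum) when K is invertible. *)
Definition min_over_posdef (R : realType) (n : nat) (K : 'M[R[i]]_n)
    (F : 'M[R[i]]_n -> R) (m : R) : Prop :=
  infimums [set F Z | Z in @posdefmx R n] m /\
  (K \in unitmx -> is_min [set F Z | Z in @posdefmx R n] m).

Definition max_over_posdef (R : realType) (n : nat) (K : 'M[R[i]]_n)
    (F : 'M[R[i]]_n -> R) (m : R) : Prop :=
  supremums [set F Z | Z in @posdefmx R n] m /\
  (K \in unitmx -> is_max [set F Z | Z in @posdefmx R n] m).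

(* Main.v *)
Require Import Defs.
From mathcomp Require Import all_boot all_order all_algebra.
From mathcomp Require Import complex.
From mathcomp Require Import boolp classical_sets reals exp.
From mathcomp Require Import perm ring lra.

(** Put T = B^(q/2) K^* A^p K B^(q/2).  For Z > 0 write Q = A^(p/2) K and
    Q B^(q/2) = (Q Z^(-1/2)) (Z^(1/2) B^(q/2)).  Horn's inequalities
    prod_(i < k) s_i(XY) <= prod_(i < k) s_i(X) s_i(Y) say that the singular
    values of a product are weakly log-majorized by the products of the singular
    values.  A symmetric gauge function is monotone under weak
    log-majorization and satisfies Hoelder's inequality, which gives the lower
    bound in (i); for (ii) use Q Z^(-1/2) = (Q B^(q/2)) (B^(-q/2) Z^(-1/2))
    instead.  The two forms are compared by Young's inequality.  Equality is
    attained at Z = B^(-q/2) T^(sq) B^(-q/2) when T > 0, and in general it is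
    approached with T + eps in place of T. *)

Set Implicit Arguments.
Unset Strict Implicit.
Unset Printing Implicit Defensive.

Import Order.TTheory GRing.Theory Num.Theory.
Local Open Scope classical_set_scope.
Local Open Scope ring_scope.
Local Open Scope complex_scope.
Local Open Scope sesquilinear_scope.

(** * Symmetric gauge functions *)

(** This is [conjugate_powR] for u^(1-t) and v^t with exponents 1/(1-t) and 1/t. *)
Lemma young_powR (R : realType) (t u v : R) : 0 < t < 1 -> 0 <= u -> 0 <= v ->
  u `^ (1 - t) * v `^ t <= (1 - t) * u + t * v.
Proof.
move=> /andP[t0 t1] u0 v0.
have t1' : 0 < 1 - t by rewrite subr_gt0.
have := @conjugate_powR R (u `^ (1 - t)) (v `^ t) (1 - t)^-1 t^-1
  (powR_ge0 _ _) (powR_ge0 _ _).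
rewrite !invr_gt0 !invrK => /(_ t1' t0); rewrite subrK => /(_ erefl).
rewrite -!powRrM !mulfV ?gt_eqF// !powRr1//.
by rewrite (mulrC u) (mulrC v).
Qed.

Section Gauge.
Variables (R : realType) (n : nat) (Phi : 'rV[R]_n -> R).
Hypothesis gaugePhi : symmetric_gauge Phi.

Lemma gauge_ge0 x : 0 <= Phi x.
Proof. by case: gaugePhi => -[]. Qed.

Lemma gauge_eq0 x : Phi x = 0 -> x = 0.
Proof. by case: gaugePhi => -[_ + _ _ _ _ _]; apply. Qed.

Lemma gauge_perm sigma x : Phi (col_perm sigma x) = Phi x.
Proof. by case: gaugePhi. Qed.

Lemma gaugeZ a x : 0 <= a -> Phi (a *: x) = a * Phi x.
Proof. by move=> a0; case: gaugePhi => -[_ _ -> _] _ _ _; rewrite ger0_norm. Qed.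

Lemma gaugeD x y : Phi (x + y) <= Phi x + Phi y.
Proof. by case: gaugePhi => -[_ _ _ + _ _ _]; apply. Qed.

Lemma gauge_conv a b x y : 0 <= a -> 0 <= b ->
  Phi (a *: x + b *: y) <= a * Phi x + b * Phi y.
Proof. by move=> a0 b0; rewrite (le_trans (gaugeD _ _))// !gaugeZ. Qed.

Lemma gauge0 : Phi 0 = 0.
Proof. by rewrite -(scale0r 0) gaugeZ// mul0r. Qed.

(** In dimension 0 the normalizing row is the zero row, whose gauge would be both 1 and 0. *)
Lemma gauge_dim_gt0 : (0 < n)%N.
Proof.
rewrite lt0n; apply/eqP => n0; have := oner_neq0 R.
case: gaugePhi => _ _ _ <-; rewrite -gauge0 => /eqP; apply; congr Phi.
by apply/rowP => -[i lt_i]; exfalso; move: lt_i; rewrite n0.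
Qed.

(** Shrinking one coordinate gives a convex combination of z and its reflection in that coordinate,
    and sign invariance gives both the same gauge. *)
Lemma gauge_upd_le (z : 'rV[R]_n) j c : `|c| <= z ord0 j ->
  Phi (\row_i (if i == j then c else z ord0 i)) <= Phi z.
Proof.
move=> cz; have z0 : 0 <= z ord0 j by apply: le_trans cz.
move: (z0); rewrite le_eqVlt => /predU1P[zj0|zj_gt0].
  rewrite le_eqVlt; apply/orP; left; apply/eqP; congr Phi.
  apply/rowP => i; rewrite mxE; case: eqP => // ->; apply/eqP.
  by rewrite -zj0 -normr_le0 zj0.
move: cz; rewrite ler_norml => /andP[cz1 cz2].
pose t := c / z ord0 j.
have t1 : -1 <= t by rewrite ler_pdivlMr// mulN1r.
have t2 : t <= 1 by rewrite ler_pdivrMr// mul1r.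
have -> : \row_i (if i == j then c else z ord0 i) =
    ((1 + t) / 2) *: z + ((1 - t) / 2) *: \row_i ((-1) ^+ (i == j) * z ord0 i).
  apply/rowP => i; rewrite !mxE; case: eqP => [->|_] /=; rewrite /t; field;
    by rewrite gt_eqF.
have t1' : 0 <= (1 + t) / 2 by lra.
have t2' : 0 <= (1 - t) / 2 by lra.
apply: (le_trans (gauge_conv _ _ t1' t2')).
case: gaugePhi => _ _ /(_ (fun i => i == j)) -> _.
by rewrite -mulrDl -[leRHS]mul1r ler_wpM2r ?gauge_ge0//; lra.
Qed.

(** Switch the coordinates from y to x one at a time by [gauge_upd_le]. *)
Lemma gauge_le (x y : 'rV[R]_n) : (forall i, `|x ord0 i| <= y ord0 i) -> Phi x <= Phi y.
Proof.
move=> xy.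
suff H (s : seq 'I_n) : uniq s ->
    Phi (\row_i (if i \in s then x ord0 i else y ord0 i)) <= Phi y.
  have := H _ (enum_uniq 'I_n); congr (Phi _ <= _).
  by apply/rowP => i; rewrite mxE mem_enum.
elim: s => [_|j s IHs /andP[js /IHs]].
  by rewrite le_eqVlt; apply/orP; left; apply/eqP; congr Phi; apply/rowP => i; rewrite mxE.
apply: le_trans.
have := @gauge_upd_le (\row_i (if i \in s then x ord0 i else y ord0 i)) j (x ord0 j).
rewrite mxE (negbTE js) => /(_ (xy j)); congr (Phi _ <= _); apply/rowP => i.
by rewrite !mxE inE; case: eqP => [->|].
Qed.

(** After scaling u and v to gauge 1, Young's inequality holds coordinatewise; monotonicity and
    convexity of Phi finish. If Phi u or Phi v is zero, both sides vanish. *)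
Lemma gauge_holder (t : R) (u v : 'rV[R]_n) : 0 < t < 1 ->
  (forall i, 0 <= u ord0 i) -> (forall i, 0 <= v ord0 i) ->
  Phi (\row_i (u ord0 i `^ (1 - t) * v ord0 i `^ t)) <= Phi u `^ (1 - t) * Phi v `^ t.
Proof.
move=> t01 u0 v0; have /andP[t0 t1] := t01.
have t1' : 0 < 1 - t by rewrite subr_gt0.
have [/gauge_eq0 Pu|Pu] := eqVneq (Phi u) 0.
  rewrite Pu gauge0 powR0 ?gt_eqF// mul0r le_eqVlt; apply/orP; left; apply/eqP.
  rewrite -gauge0; congr Phi; apply/rowP => i.
  by rewrite !mxE powR0 ?gt_eqF// mul0r.
have [/gauge_eq0 Pv|Pv] := eqVneq (Phi v) 0.
  rewrite Pv gauge0 powR0 ?gt_eqF// mulr0 le_eqVlt; apply/orP; left; apply/eqP.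
  rewrite -gauge0; congr Phi; apply/rowP => i.
  by rewrite !mxE powR0 ?gt_eqF// mulr0.
have Pu0 : 0 < Phi u by rewrite lt_neqAle eq_sym Pu gauge_ge0.
have Pv0 : 0 < Phi v by rewrite lt_neqAle eq_sym Pv gauge_ge0.
set c := _ * _.
have c0 : 0 < c by rewrite mulr_gt0 ?powR_gt0.
have a0 : 0 <= c * ((1 - t) / Phi u) by rewrite mulr_ge0 ?divr_ge0// ltW.
have b0 : 0 <= c * (t / Phi v) by rewrite mulr_ge0 ?divr_ge0// ltW.
have -> : c = (c * ((1 - t) / Phi u)) * Phi u + (c * (t / Phi v)) * Phi v.
  by field; rewrite Pu Pv.
apply: le_trans (gauge_conv _ _ a0 b0); apply: gauge_le => i.
rewrite !mxE ger0_norm ?mulr_ge0 ?powR_ge0//.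
have -> : u ord0 i `^ (1 - t) * v ord0 i `^ t =
    c * ((u ord0 i / Phi u) `^ (1 - t) * (v ord0 i / Phi v) `^ t).
  rewrite !powRM ?invr_ge0 ?gauge_ge0//.
  have pV r a : 0 < r -> r^-1 `^ a = (r `^ a)^-1.
    by move=> r0; rewrite -powRN -mulN1r powRrM powR_inv1// ltW.
  rewrite !pV// /c; field; rewrite !gt_eqF ?powR_gt0//.
clearbody c.
have -> : c * ((1 - t) / Phi u) * u ord0 i + c * (t / Phi v) * v ord0 i =
    c * ((1 - t) * (u ord0 i / Phi u) + t * (v ord0 i / Phi v)) by ring.
rewrite ler_pM2l//.
by apply: young_powR => //; rewrite divr_ge0 ?gauge_ge0.
Qed.

(** With the product fixed, moving two entries together lowers their sum, so the new row is
    dominated by a convex combination of y and y with entries j and k exchanged. *)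
Lemma gauge_transfer (y : 'rV[R]_n) j k a b : 0 < a -> y ord0 k <= a -> a <= y ord0 j ->
    j != k -> 0 <= b -> a * b = y ord0 j * y ord0 k -> (forall i, 0 <= y ord0 i) ->
  Phi (\row_i (if i == j then a else if i == k then b else y ord0 i)) <= Phi y.
Proof.
move=> a0 ka aj jk b0 ab y0.
have [yjk|yjk] := eqVneq (y ord0 j) (y ord0 k).
  have aE : a = y ord0 j by apply/eqP; rewrite eq_le aj yjk ka.
  have bE : b = y ord0 k.
    by apply: (mulfI (lt0r_neq0 a0)); rewrite ab aE.
  rewrite le_eqVlt; apply/orP; left; apply/eqP; congr Phi; apply/rowP => i.
  by rewrite mxE aE bE; case: eqP => [->//|_]; case: eqP => [->|].
have d0 : 0 < y ord0 j - y ord0 k.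
  by rewrite subr_gt0 lt_neqAle eq_sym yjk (le_trans ka).
pose t := (a - y ord0 k) / (y ord0 j - y ord0 k).
have t0 : 0 <= t by rewrite divr_ge0 ?(ltW d0)// subr_ge0.
have t1 : 0 <= 1 - t by rewrite subr_ge0 ler_pdivrMr// mul1r lerB.
have aE : a = t * y ord0 j + (1 - t) * y ord0 k.
  by rewrite /t; field; rewrite gt_eqF.
have bE : b <= t * y ord0 k + (1 - t) * y ord0 j.
  have -> : t * y ord0 k + (1 - t) * y ord0 j = y ord0 j + y ord0 k - a.
    by rewrite aE; ring.
  (* Right side minus left side is (a - y_k)(y_j - a) >= 0. *)
  rewrite -(ler_pM2l a0) ab; nra.
have := gauge_conv y (col_perm (tperm j k) y) t0 t1.
rewrite gauge_perm -mulrDl (addrC t) subrK mul1r; apply: le_trans.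
apply: gauge_le => i; rewrite !mxE; case: eqP => [->|/eqP ij].
  by rewrite tpermL aE ger0_norm// -aE ltW.
case: eqP => [->|/eqP ik]; first by rewrite tpermR ger0_norm.
by rewrite tpermD 1?eq_sym// ger0_norm// -mulrDl (addrC t) subrK mul1r.
Qed.

(* Multiplicative analogue of the T-transform argument: as long as some
   x_k > y_k, there is j < k with y_j > x_j, and moving y_j and y_k towards
   each other with fixed product until one of them meets x decreases the
   number of indices where x and y differ. *)
Lemma gauge_log_majorization (x y : 'rV[R]_n) :
    (forall i, 0 <= x ord0 i) -> (forall i, 0 <= y ord0 i) ->
    (forall i j : 'I_n, (i <= j)%N -> x ord0 j <= x ord0 i) ->
    (forall m, \prod_(i < n | (i < m)%N) x ord0 i <= \prod_(i < n | (i < m)%N) y ord0 i) ->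
  Phi x <= Phi y.
Proof.
move=> x0 + xdec; have [N] := ubnP #|[pred i | x ord0 i != y ord0 i]|.
elim: N y => // N IHN y; rewrite ltnS => leN y0 xy.
have [/existsP[k0 xk0]|/existsPn xley] := boolP [exists k, y ord0 k < x ord0 k]; last first.
  by apply: gauge_le => i; rewrite ger0_norm// leNgt.
have [k ltk kmin] := @arg_minnP _ k0 (fun k => y ord0 k < x ord0 k) val xk0.
have xk_gt0 : 0 < x ord0 k by apply: le_lt_trans ltk.
have lek (i : 'I_n) : (i < k)%N -> x ord0 i <= y ord0 i.
  by move=> ik; rewrite leNgt; apply/negP => /kmin; rewrite leqNgt ik.
have prod_gt0 m : (m <= k.+1)%N -> 0 < \prod_(i < n | (i < m)%N) x ord0 i.
  move=> mk; apply: prodr_gt0 => i im; apply: lt_le_trans xk_gt0 (xdec _ _ _).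
  by rewrite -ltnS (leq_trans im).
have prodS (z : 'rV[R]_n) : \prod_(i < n | (i < k.+1)%N) z ord0 i =
    z ord0 k * \prod_(i < n | (i < k)%N) z ord0 i.
  rewrite (bigD1 k)//=; congr (_ * _); apply: eq_bigl => i.
  by rewrite ltnS [RHS]ltn_neqAle andbC.
have yk_gt0 : 0 < y ord0 k.
  rewrite lt_neqAle y0 andbT eq_sym; apply/eqP => yk.
  by have := lt_le_trans (prod_gt0 k.+1 (leqnn _)) (xy k.+1); rewrite prodS yk mul0r ltxx.
(* If y agreed with x before k, then x_k > y_k would break the prefix inequality at k + 1. *)
have [/existsP[j /andP[jk ltj]]|/existsPn nojk] :=
    boolP [exists j : 'I_n, (j < k)%N && (x ord0 j < y ord0 j)]; last first.
  have := xy k.+1; rewrite !prodS.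
  have -> : \prod_(i < n | (i < k)%N) y ord0 i = \prod_(i < n | (i < k)%N) x ord0 i.
    apply: eq_bigr => i ik; apply/eqP; rewrite eq_le lek// andbT leNgt.
    by have := nojk i; rewrite ik.
  by rewrite ler_pM2r ?prod_gt0// leNgt ltk.
have jneqk : j != k by rewrite -val_eqE /= ltn_eqF.
have xj_gt0 : 0 < x ord0 j by apply: lt_le_trans xk_gt0 (xdec _ _ (ltnW jk)).
have yj_gt0 : 0 < y ord0 j by apply: lt_trans ltj.
(* The largest factor for which y_j / c >= x_j and c y_k <= x_k; one of the two becomes an
   equality. *)
pose c := Num.min (y ord0 j / x ord0 j) (x ord0 k / y ord0 k).
have c1 : 1 < c by rewrite lt_min !ltr_pdivlMr// !mul1r ltj.
have c0 : 0 < c by apply: lt_trans c1.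
have cj : x ord0 j <= y ord0 j / c.
  by rewrite ler_pdivlMr// mulrC -ler_pdivlMr// ge_min lexx.
have ck : c * y ord0 k <= x ord0 k.
  by rewrite -ler_pdivlMr// ge_min lexx orbT.
pose y' := \row_i (if i == j then y ord0 j / c else
                   if i == k then c * y ord0 k else y ord0 i).
have y'j : y' ord0 j = y ord0 j / c by rewrite mxE eqxx.
have y'k : y' ord0 k = c * y ord0 k by rewrite mxE eq_sym (negbTE jneqk) eqxx.
have y'i i : i != j -> i != k -> y' ord0 i = y ord0 i.
  by move=> ij ik; rewrite mxE (negbTE ij) (negbTE ik).
apply: (@le_trans _ _ (Phi y')); last first.
  apply: gauge_transfer => //.
  - by rewrite divr_gt0.
  - by apply: le_trans cj; apply: le_trans (xdec _ _ (ltnW jk)); apply: ltW.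
  - by rewrite ler_pdivrMr// ler_peMr// ltW.
  - by rewrite mulr_ge0// ltW.
  - by field; rewrite gt_eqF.
apply: IHN.
- apply: leq_trans leN; apply: proper_card; apply/properP; split.
    apply/fintype.subsetP => i; rewrite !inE mxE.
    case: (i =P j) => [->|_]; first by rewrite (lt_eqF ltj).
    by case: (i =P k) => [->|_]; first by rewrite (gt_eqF ltk).
  have [cE|cE] := leP (y ord0 j / x ord0 j) (x ord0 k / y ord0 k).
    exists j; rewrite !inE ?(lt_eqF ltj)// y'j /c min_l// negbK.
    by apply/eqP; field; rewrite !gt_eqF.
  exists k; rewrite !inE ?(gt_eqF ltk)// y'k /c min_r ?ltW// negbK.
  by apply/eqP; field; rewrite !gt_eqF.
- move=> i; rewrite mxE; case: ifP => _; first by rewrite divr_ge0// ltW.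
  by case: ifP => _ //; rewrite mulr_ge0// ltW.
(* A prefix of length at most k meets no index where the new row is below x; a longer one contains
   both j and k, so its product is unchanged. *)
move=> m; have [mk|km] := leqP m k.
  apply: ler_prod => i im; rewrite x0/=; have ik := leq_trans im mk.
  have [->|ij] := eqVneq i j; first by rewrite y'j.
  by rewrite y'i ?lek// -val_eqE /= ltn_eqF.
have jm := ltn_trans jk km.
apply: le_trans (xy m) _; rewrite le_eqVlt; apply/orP; left; apply/eqP.
rewrite (bigD1 j)//= [RHS](bigD1 j)//=.
rewrite (bigD1 k) ?km 1?eq_sym//= [in RHS](bigD1 k) ?km 1?eq_sym//=.
rewrite y'j y'k !mulrA; congr (_ * _); first by field; rewrite gt_eqF.
by apply: eq_bigr => i /andP[/andP[_ ij] ik]; rewrite y'i.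
Qed.

End Gauge.

(** * Compressed determinants *)

(** Multilinearity in the rows of the product gives one term per map f. Keeping all maps avoids
    choosing increasing representatives as in Cauchy-Binet. *)
Lemma det_mulmx_rect (R : comNzRingType) k n (A : 'M[R]_(k, n)) (B : 'M[R]_(n, k)) :
  \det (A *m B) =
  \sum_(f : {ffun 'I_k -> 'I_n}) (\prod_i A i (f i)) * \det (\matrix_(i, j) B (f i) j).
Proof.
pose AB (s : 'S_k) i j := A i j * B j (s i).
transitivity (\sum_(f : {ffun 'I_k -> 'I_n}) \sum_(s : 'S_k)
    (-1) ^+ s * \prod_i AB s i (f i)).
  rewrite exchange_big; apply: eq_bigr => /= s _; rewrite -big_distrr /=.
  congr (_ * _); rewrite -(bigA_distr_bigA (AB s)) /=.
  by apply: eq_bigr => i _; rewrite mxE.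
apply: eq_bigr => f _; rewrite big_distrr /=; apply: eq_bigr => s _.
rewrite mulrCA big_split //=; congr (_ * (_ * _)).
by apply: eq_bigr => i _; rewrite mxE.
Qed.

Section CauchyBinet.
Variables (C : numClosedFieldType) (k n : nat).
Implicit Types (V : 'M[C]_(n, k)) (d : 'rV[C]_n).

(** Cauchy-Binet for V^* D V. Each k-subset is the image of k! injective maps and the other maps
    contribute zero, whence the factor k! on the left. *)
Lemma det_gram_diag V d :
  (\det (V^t* *m diag_mx d *m V)) *+ k`! =
  \sum_(f : {ffun 'I_k -> 'I_n})
    (\prod_i d 0 (f i)) * `|\det (\matrix_(i, j) V (f i) j)| ^+ 2.
Proof.
pose D (f : {ffun 'I_k -> 'I_n}) := \det (\matrix_(i, j) V (f i) j).
pose E (f : {ffun 'I_k -> 'I_n}) (s : 'S_k) : {ffun 'I_k -> 'I_n} := [ffun i => f (s i)].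
transitivity (\sum_(s : 'S_k) \sum_(f : {ffun 'I_k -> 'I_n})
   (\prod_i d 0 (f i)) * D f * ((-1) ^+ s * \prod_i (V (f (s i)) i)^*)).
  (* Take one copy of the determinant per permutation s and reindex its sum by f o s; summing over s
     then assembles the conjugate minor. *)
  rewrite -[in LHS]card_Sn -sumr_const; apply: eq_bigr => s _.
  rewrite det_mulmx_rect (reindex_inj (h := fun f => E f s)); last first.
    move=> f g /ffunP fg; apply/ffunP => i.
    by have := fg (s^-1%g i); rewrite !ffunE permKV.
  apply: eq_bigr => f _; rewrite /D.
  have -> : \det (\matrix_(i, j) V (E f s i) j) = (-1) ^+ s * \det (\matrix_(i, j) V (f i) j).
    rewrite -det_perm -det_mulmx; congr (\det _); apply/matrixP => i j.
    rewrite [RHS]mxE (bigD1 (s i))//= big1 => [|l lsi]; last first.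
      by rewrite !mxE eq_sym (negbTE lsi) mul0r.
    by rewrite !mxE eqxx mul1r addr0 ffunE.
  have -> : \prod_i (V^t* *m diag_mx d) i (E f s i) =
      (\prod_i (V (f (s i)) i)^*) * \prod_i d 0 (f i).
    rewrite [X in _ * X](reindex_inj (h := s)) /=; last exact: perm_inj.
    by rewrite -big_split /=; apply: eq_bigr => i _; rewrite mul_mx_diag !mxE ffunE.
  have ring4 (a b c e : C) : a * b * (c * e) = b * e * (c * a) by ring.
  exact: ring4.
rewrite exchange_big; apply: eq_bigr => f _ /=.
rewrite -big_distrr /= -mulrA; congr (_ * _).
rewrite normCK; congr (_ * _); rewrite -det_tr /determinant rmorph_sum.
apply: eq_bigr => s _; rewrite rmorphM /= rmorph_sign rmorph_prod; congr (_ * _).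
by apply: eq_bigr => i _; rewrite !mxE.
Qed.

(** Compare the expansion termwise with that for D = 1. A non-injective f selects two equal rows, so
    its minor vanishes. *)
Lemma det_gram_diag_le V d c : (forall i, 0 <= d 0 i) ->
    (forall f : 'I_k -> 'I_n, injective f -> \prod_i d 0 (f i) <= c) ->
  \det (V^t* *m diag_mx d *m V) <= c * \det (V^t* *m V).
Proof.
move=> d0 dc; have k0 : (0 < k`!)%N by rewrite fact_gt0.
rewrite -(ler_pMn2r k0) -mulrnAr.
have -> : V^t* *m V = V^t* *m diag_mx (const_mx 1) *m V.
  by rewrite diag_const_mx mulmx1.
rewrite !det_gram_diag mulr_sumr; apply: ler_sum => f _.
rewrite [\prod_i (const_mx 1) _ _]big1 ?mul1r => [|i _]; last by rewrite mxE.
have [/injectiveP finj|/injectivePn[i [j ij fij]]] := boolP (injectiveb f).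
  by rewrite ler_wpM2r ?exprn_ge0// dc.
rewrite (determinant_alternate ij) ?normr0 ?expr0n ?mulr0// => l.
by rewrite !mxE fij.
Qed.

End CauchyBinet.

(** Let S be the image of f and T the first k indices. After splitting off the common factors, each
    entry over S \ T is at most d_k (counting from 0), which is at most each entry over T \ S, and
    these sets have equal size. *)
Lemma prod_inj_le (R : realDomainType) k n (d : 'rV[R]_n) (f : 'I_k -> 'I_n) :
    (forall i, 0 <= d 0 i) -> (forall i j : 'I_n, (i <= j)%N -> d 0 j <= d 0 i) ->
    injective f ->
  \prod_i d 0 (f i) <= \prod_(i < n | (i < k)%N) d 0 i.
Proof.
move=> d0 ddec finj; pose S := [set f i | i : 'I_k]%SET; pose T := [set i : 'I_n | (i < k)%N]%SET.
have -> : \prod_i d 0 (f i) = \prod_(i in S) d 0 i.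
  by rewrite big_imset //= => i j _ _; apply: finj.
have -> : \prod_(i < n | (i < k)%N) d 0 i = \prod_(i in T) d 0 i.
  by apply: eq_bigl => i; rewrite inE.
have cS : #|S| = k by rewrite card_imset ?card_ord.
have kn : (k <= n)%N by rewrite -cS -[leqRHS]card_ord max_card.
have cT : #|T| = k.
  have winj : injective (widen_ord kn) by move=> i j /(congr1 val)/= /val_inj.
  rewrite -[RHS]card_ord -(card_imset _ winj); congr #|pred_of_set _|.
  apply/setP => i; rewrite inE; apply/idP/imsetP => [ik|[j _ ->]]; last by rewrite /=.
  by exists (Ordinal ik) => //; apply: val_inj.
rewrite (big_setID T) /= [leRHS](big_setID S) /= finset.setIC.
apply: ler_wpM2l; first by apply: prodr_ge0.
have cST : #|S :\: T| = #|T :\: S| by rewrite !cardsD finset.setIC cS cT.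
have [ST0|[j0]] := set_0Vmem (S :\: T).
  move: cST; rewrite ST0 cards0 => /esym/eqP; rewrite cards_eq0 => /eqP ->.
  by rewrite !big_set0.
rewrite !inE -leqNgt => /andP[kj0 _].
have n0 : (0 < n)%N by apply: leq_ltn_trans (ltn_ord j0).
have lj i : i \in S :\: T -> d 0 i <= d 0 (Ordinal (leq_ltn_trans kj0 (ltn_ord j0))).
  by rewrite !inE -leqNgt => /andP[ki _]; apply: ddec.
have ljT i : i \in T :\: S -> d 0 (Ordinal (leq_ltn_trans kj0 (ltn_ord j0))) <= d 0 i.
  by rewrite !inE => /andP[_ ik]; apply/ddec/ltnW.
apply: (@le_trans _ _ (\prod_(i in S :\: T) d 0 (Ordinal (leq_ltn_trans kj0 (ltn_ord j0))))).
  by apply: ler_prod => i /lj ->; rewrite d0.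
rewrite prodr_const cST -prodr_const.
by apply: ler_prod => i /ljT ->; rewrite d0.
Qed.

(** * Unitary diagonalization *)

(** From P A = B P follows P (X - A) = (X - B) P; take determinants and cancel det P. *)
Lemma char_poly_similar (F : fieldType) n (P A B : 'M[F]_n) :
  P \in unitmx -> P *m A = B *m P -> char_poly A = char_poly B.
Proof.
rewrite unitmxE unitfE => P0 PA.
have P0' : \det (map_mx polyC P) != 0 by rewrite det_map_mx polyC_eq0.
apply: (mulfI P0'); rewrite /char_poly -det_mulmx [RHS]mulrC -det_mulmx; congr (\det _).
rewrite /char_poly_mx mulmxBr mulmxBl -!map_mxM PA.
by rewrite mul_scalar_mx mul_mx_scalar.
Qed.

(** Turns equality of value lists up to order into a permutation of indices, the form in which a
    gauge is invariant. *)
Lemma perm_tuple_row (T : eqType) n (x y : 'I_n -> T) :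
  perm_eq [seq x i | i <- enum 'I_n] [seq y i | i <- enum 'I_n] ->
  exists sigma : 'S_n, forall i, x i = y (sigma i).
Proof.
have -> : [seq y i | i <- enum 'I_n] = [tuple y i | i < n].
  by rewrite /= enumT.
move=> /tuple_permP[sigma xE]; exists sigma => i.
have := congr1 (nth (x i) ^~ i) xE.
rewrite (nth_map i) ?size_enum_ord// nth_ord_enum.
rewrite (nth_map i) ?size_enum_ord// nth_ord_enum => ->.
by rewrite tnth_mktuple.
Qed.

Lemma nth_sort_perm (R : realType) n (x : 'I_n -> R) :
  exists sigma : 'S_n, forall i : 'I_n,
    nth 0 (sort (fun a b : R => b <= a) [seq x i | i <- enum 'I_n]) i = x (sigma i).
Proof.
set s := sort _ _.
have ps : perm_eq s [seq x i | i <- enum 'I_n] by rewrite perm_sort.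
have ss : size s = n by rewrite (perm_size ps) size_map size_enum_ord.
apply: (@perm_tuple_row _ n (fun i => nth 0 s i) x).
have -> : [seq nth 0 s i | i : 'I_n <- enum 'I_n] = s; last by [].
by rewrite -[RHS](mkseq_nth 0) ss /mkseq -val_enum_ord -map_comp.
Qed.

Section UnitaryDiag.
Variable R : realType.
Local Notation C := R[i].

Lemma conjCR (a : R) : Num.conj (a%:C : C) = a%:C.
Proof. exact: conjc_real. Qed.

Lemma trmxC_mul m n p (A : 'M[C]_(m, n)) (B : 'M[C]_(n, p)) :
  (A *m B)^t* = B^t* *m A^t*.
Proof. by rewrite trmx_mul map_mxM. Qed.

Variable n : nat.
Implicit Types (A B U : 'M[C]_n) (d : 'rV[R]_n).

Definition diagC d : 'M[C]_n := diag_mx (\row_i (d ord0 i)%:C).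

Lemma hermsymmxP A : reflect (A^t* = A) (A \is hermsymmx).
Proof.
by apply: (iffP (is_hermitianmxP _ _ _)); rewrite expr0 scale1r.
Qed.

Lemma diagCM d e : diagC d *m diagC e = diagC (\row_i (d ord0 i * e ord0 i)).
Proof.
by rewrite /diagC mulmx_diag; congr diag_mx; apply/rowP => i; rewrite !mxE rmorphM.
Qed.

Lemma diagC_trmxC d : (diagC d)^t* = diagC d.
Proof.
rewrite /diagC tr_diag_mx map_diag_mx; congr diag_mx; apply/rowP => i.
by rewrite !mxE; apply: conjCR.
Qed.

Lemma diagC1 : diagC (const_mx 1) = 1%:M.
Proof.
by rewrite -diag_const_mx; congr diag_mx; apply/rowP => i; rewrite !mxE.
Qed.

Lemma udiagM U d e : U \is unitarymx ->
  (U^t* *m diagC d *m U) *m (U^t* *m diagC e *m U) =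
  U^t* *m diagC (\row_i (d ord0 i * e ord0 i)) *m U.
Proof. by move=> UU; rewrite -diagCM !mulmxA mulmxtVK. Qed.

Lemma udiag_trmxC U d : (U^t* *m diagC d *m U)^t* = U^t* *m diagC d *m U.
Proof. by rewrite !trmxC_mul trmxCK diagC_trmxC mulmxA. Qed.

Lemma char_poly_udiag U d : U \is unitarymx ->
  char_poly (U^t* *m diagC d *m U) = \prod_i ('X - ((d ord0 i)%:C)%:P).
Proof.
move=> UU; rewrite (@char_poly_similar _ _ U _ (diagC d)) ?unitarymx_unit//.
  rewrite char_poly_trig ?diag_mx_is_trig//; apply: eq_bigr => i _.
  by rewrite !mxE eqxx.
by rewrite !mulmxA (unitarymxP UU) mul1mx.
Qed.

Definition spectrum A : 'rV[R]_n := \row_i complex.Re (spectral_diag A ord0 i).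

Lemma spectrumP A : A \is hermsymmx ->
  A = (spectralmx A)^t* *m diagC (spectrum A) *m spectralmx A.
Proof.
move=> hA; have /orthomx_spectralP {1}-> := hermitian_normalmx hA.
rewrite (invmx_unitary (spectral_unitarymx A)) /diagC.
suff <- : spectral_diag A = \row_i (spectrum A ord0 i)%:C by [].
apply/rowP => i; rewrite !mxE RRe_real//.
by have /mxOverP -> := hermitian_spectral_diag_real hA.
Qed.

Lemma mxpowE A t : mxpow A t =
  (spectralmx A)^t* *m diagC (\row_i (spectrum A ord0 i) `^ t) *m spectralmx A.
Proof.
rewrite /mxpow /diagC.
suff -> : (\row_i (complex.Re (spectral_diag A ord0 i) `^ t)%:C : 'rV[C]_n) =
   \row_i ((\row_i (spectrum A ord0 i) `^ t) ord0 i)%:C by [].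
by apply/rowP => i; rewrite !mxE.
Qed.

(** Unique factorization of the characteristic polynomial determines the eigenvalues up to order. *)
Lemma spectrum_char_poly A d : A \is hermsymmx ->
    char_poly A = \prod_i ('X - ((d ord0 i)%:C)%:P) ->
  exists sigma : 'S_n, spectrum A = col_perm sigma d.
Proof.
move=> hA; rewrite {1}(spectrumP hA) char_poly_udiag ?spectral_unitarymx// => E.
have [|sigma sE] := @perm_tuple_row _ n (spectrum A ord0) (d ord0).
  apply: (perm_map_inj (@complexI R)); apply: prod_XsubC_eq.
  by rewrite !big_map.
by exists sigma; apply/rowP => i; rewrite sE mxE.
Qed.

Lemma spectrum_udiag U d : U \is unitarymx ->
  exists sigma : 'S_n, spectrum (U^t* *m diagC d *m U) = col_perm sigma d.
Proof.
move=> UU; apply: spectrum_char_poly; last exact: char_poly_udiag.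
by apply/hermsymmxP; rewrite udiag_trmxC.
Qed.

(** Here A^* A = U^* diag(d_i^2) U, and the square roots return the d_i because these are
    nonnegative. *)
Lemma singular_values_udiag U d : U \is unitarymx -> (forall i, 0 <= d ord0 i) ->
  exists sigma : 'S_n, singular_values (U^t* *m diagC d *m U) = col_perm sigma d.
Proof.
move=> UU d0; set A := _ *m U.
have [tau tauE] := spectrum_udiag (\row_i (d ord0 i * d ord0 i)) UU.
have sE : singular_seq A = [seq d ord0 (tau i) | i <- enum 'I_n].
  apply: eq_map => i; rewrite udiag_trmxC udiagM//.
  have /rowP/(_ i) := tauE; rewrite !mxE => ->.
  by rewrite -expr2 sqrtr_sqr ger0_norm.
have [sigma sgE] := nth_sort_perm (fun i => d ord0 (tau i)).
by exists (sigma * tau)%g; apply/rowP => i; rewrite [LHS]mxE [RHS]mxE permM sE; apply: sgE.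
Qed.

End UnitaryDiag.

(** * Horn's inequalities *)

Lemma row_sort_decreasing (R : realType) n (d : 'rV[R]_n) :
  exists sigma : 'S_n, forall i j : 'I_n, (i <= j)%N ->
    d ord0 (sigma j) <= d ord0 (sigma i).
Proof.
have [sigma sgE] := nth_sort_perm (d ord0).
exists sigma => i j ij; rewrite -!sgE.
pose r := fun a b : R => b <= a.
have rtr : transitive r by move=> x y z xy yz; apply: le_trans yz xy.
have rtot : total r by move=> x y; apply: le_total.
have rrefl : reflexive r by move=> x; apply: lexx.
have ss : size (sort r [seq d ord0 i | i <- enum 'I_n]) = n.
  by rewrite size_sort size_map size_enum_ord.
by apply: (sorted_leq_nth rtr rrefl 0 (sort_sorted rtot _)); rewrite ?inE ?ss.
Qed.

Section Horn.
Variables (R : realType) (n : nat).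
Local Notation C := R[i].
Implicit Types (A B U X Y : 'M[C]_n) (d x y z : 'rV[R]_n).

Definition decreasing d := forall i j : 'I_n, (i <= j)%N -> d ord0 j <= d ord0 i.

Lemma row_perm_unitary (sigma : 'S_n) U : U \is unitarymx -> row_perm sigma U \is unitarymx.
Proof.
move=> /unitarymxP/matrixP UU; apply/unitarymxP/matrixP => i j.
have := UU (sigma i) (sigma j); rewrite !mxE (inj_eq perm_inj) => <-.
by apply: eq_bigr => k _; rewrite !mxE.
Qed.

Lemma udiag_perm (sigma : 'S_n) U d :
  U^t* *m diagC d *m U =
  (row_perm sigma U)^t* *m diagC (col_perm sigma d) *m row_perm sigma U.
Proof.
apply/matrixP => i j; rewrite /diagC !mul_mx_diag [LHS]mxE [RHS]mxE.
rewrite (reindex_inj (h := sigma)) /=; last exact: perm_inj.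
by apply: eq_bigr => k _; rewrite !mxE.
Qed.

Lemma hermitian_decreasing A : A \is hermsymmx ->
  exists U d, [/\ U \is unitarymx, A = U^t* *m diagC d *m U & decreasing d].
Proof.
move=> hA; have [sigma sP] := row_sort_decreasing (spectrum A).
exists (row_perm sigma (spectralmx A)), (col_perm sigma (spectrum A)); split.
- exact/row_perm_unitary/spectral_unitarymx.
- by rewrite -udiag_perm -spectrumP.
- by move=> i j ij; rewrite !mxE; have := sP _ _ ij; rewrite !mxE.
Qed.

Lemma gram_hermitian m (X : 'M[C]_(m, n)) : X^t* *m X \is hermsymmx.
Proof. by apply/hermsymmxP; rewrite trmxC_mul trmxCK. Qed.

Lemma gram_diag_ge0 m (X : 'M[C]_(m, n)) i : 0 <= (X^t* *m X) i i.
Proof.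
rewrite mxE; apply: sumr_ge0 => j _; rewrite !mxE mulrC.
exact: mul_conjC_ge0.
Qed.

Lemma udiag_conj U d : U \is unitarymx -> U *m (U^t* *m diagC d *m U) *m U^t* = diagC d.
Proof. by move=> UU; rewrite !mulmxA (unitarymxP UU) mul1mx -mulmxA (unitarymxP UU) mulmx1. Qed.

Lemma gram_udiag_ge0 X U d : U \is unitarymx -> X^t* *m X = U^t* *m diagC d *m U ->
  forall i, 0 <= d ord0 i.
Proof.
move=> UU XE i; have := gram_diag_ge0 (X *m U^t*) i.
rewrite trmxC_mul trmxCK -mulmxA (mulmxA _ X) XE mulmxA udiag_conj// !mxE eqxx mulr1n.
by rewrite ler0c.
Qed.

(** Absorbing U into V leaves a diagonal matrix, and for decreasing d the first k entries give the
    largest product over k distinct indices. *)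
Lemma det_compress_le k (V : 'M[C]_(n, k)) U d : U \is unitarymx ->
    (forall i, 0 <= d ord0 i) -> decreasing d ->
  \det (V^t* *m (U^t* *m diagC d *m U) *m V) <=
  (\prod_(i < n | (i < k)%N) d ord0 i)%:C * \det (V^t* *m V).
Proof.
move=> UU d0 ddec.
have := @det_gram_diag_le _ _ _ (U *m V) (\row_i (d ord0 i)%:C)
  (\prod_(i < n | (i < k)%N) d ord0 i)%:C.
rewrite trmxC_mul -[X in _ -> _ -> _ <= _ * \det X]mulmxA (mulmxA (U^t*)).
have UU' : U^t* *m U = 1%:M by rewrite -invmx_unitary// mulVmx ?unitarymx_unit.
rewrite UU' mul1mx !mulmxA; apply => [i|f finj]; first by rewrite mxE ler0c.
under eq_bigr do rewrite mxE.
by rewrite -rmorph_prod lecR prod_inj_le.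
Qed.

(** The rows x, y, z hold squared singular values. For V made of the top k eigenvectors of (XY)^*
    (XY), the compressed determinant is the product of the z_i; [det_compress_le] bounds it through
    X^* X with Y V, then through Y^* Y with V. *)
Lemma horn X Y Ux Uy Uz x y z : Ux \is unitarymx -> Uy \is unitarymx -> Uz \is unitarymx ->
    decreasing x -> decreasing y -> decreasing z ->
    X^t* *m X = Ux^t* *m diagC x *m Ux -> Y^t* *m Y = Uy^t* *m diagC y *m Uy ->
    (X *m Y)^t* *m (X *m Y) = Uz^t* *m diagC z *m Uz ->
  forall k, \prod_(i < n | (i < k)%N) z ord0 i <=
    (\prod_(i < n | (i < k)%N) x ord0 i) * \prod_(i < n | (i < k)%N) y ord0 i.
Proof.
move=> UUx UUy UUz xdec ydec zdec XE YE ZE.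
have x0 := gram_udiag_ge0 UUx XE; have y0 := gram_udiag_ge0 UUy YE.
(* Beyond n the prefix products no longer change, so k <= n may be assumed, as [widen_ord]
   requires. *)
suff H k : (k <= n)%N -> \prod_(i < n | (i < k)%N) z ord0 i <=
    (\prod_(i < n | (i < k)%N) x ord0 i) * \prod_(i < n | (i < k)%N) y ord0 i.
  move=> k; have [/H//|nk] := leqP k n; have := H n (leqnn n).
  have E (w : 'rV[R]_n) : \prod_(i < n | (i < k)%N) w ord0 i = \prod_(i < n | (i < n)%N) w ord0 i.
    by apply: eq_bigl => i; rewrite ltn_ord (ltn_trans _ nk).
  by rewrite !E.
move=> kn; pose V := colsub (widen_ord kn) (Uz^t*).
have VE : V^t* = rowsub (widen_ord kn) Uz.
  by apply/matrixP => i j; rewrite !mxE conjCK.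
have VV : V^t* *m V = 1%:M.
  rewrite VE mul_rowsub_mx mulmx_colsub (unitarymxP UUz).
  by apply/matrixP => i j; rewrite !mxE -val_eqE.
have VZ : \det (V^t* *m ((X *m Y)^t* *m (X *m Y)) *m V) =
    (\prod_(i < n | (i < k)%N) z ord0 i)%:C.
  rewrite ZE VE mul_rowsub_mx mul_rowsub_mx mulmx_colsub udiag_conj//.
  have -> : rowsub (widen_ord kn) (colsub (widen_ord kn) (diagC z)) =
     diag_mx (\row_i (z ord0 (widen_ord kn i))%:C).
    by apply/matrixP => i j; rewrite !mxE -val_eqE.
  rewrite det_diag (big_ord_narrow kn) rmorph_prod.
  by apply: eq_bigr => i _; rewrite mxE.
have VE1 : V^t* *m ((X *m Y)^t* *m (X *m Y)) *m V = (Y *m V)^t* *m (X^t* *m X) *m (Y *m V).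
  by rewrite !trmxC_mul !mulmxA.
have VE2 : (Y *m V)^t* *m (Y *m V) = V^t* *m (Y^t* *m Y) *m V.
  by rewrite trmxC_mul !mulmxA.
have := det_compress_le (Y *m V) UUx x0 xdec.
rewrite -XE -VE1 VZ VE2 => H1.
have := det_compress_le V UUy y0 ydec.
rewrite -YE VV det1 mulr1 => H2.
rewrite -lecR rmorphM; apply: le_trans H1 _; apply: ler_wpM2l H2.
by rewrite ler0c prodr_ge0.
Qed.

End Horn.

(** * Symmetric norms of powers *)

Section SymmetricNorm.
Variables (R : realType) (n : nat).
Local Notation C := R[i].
Variables (N : 'M[C]_n -> R) (Phi : 'rV[R]_n -> R).
Hypothesis gaugePhi : symmetric_gauge Phi.
Hypothesis NE : forall A, N A = Phi (singular_values A).

(** The power has the nonnegative eigenvalues d_i^t, which are then its singular values up to order,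
    and Phi ignores order. *)
Lemma norm_mxpow A (d : 'rV[R]_n) t : A \is hermsymmx ->
    char_poly A = \prod_i ('X - ((d ord0 i)%:C)%:P) ->
  N (mxpow A t) = Phi (\row_i (d ord0 i) `^ t).
Proof.
move=> hA chA; have [tau tauE] := spectrum_char_poly hA chA.
have [|sigma sE] := @singular_values_udiag R n _ (\row_i (spectrum A ord0 i) `^ t)
  (spectral_unitarymx A).
  by move=> i; rewrite mxE powR_ge0.
rewrite NE mxpowE sE (gauge_perm gaugePhi) tauE -[RHS](gauge_perm gaugePhi tau).
by congr Phi; apply/rowP => i; rewrite !mxE.
Qed.

Lemma norm_mxpow_udiag (U : 'M[C]_n) (d : 'rV[R]_n) t : U \is unitarymx ->
  N (mxpow (U^t* *m diagC d *m U) t) = Phi (\row_i (d ord0 i) `^ t).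
Proof.
move=> UU; apply: norm_mxpow; last exact: char_poly_udiag.
by apply/hermsymmxP; rewrite udiag_trmxC.
Qed.

Lemma powR_prod (I : finType) (P : pred I) (F : I -> R) r : (forall i, 0 <= F i) ->
  (\prod_(i | P i) F i) `^ r = \prod_(i | P i) F i `^ r.
Proof.
move=> F0.
suff [] : 0 <= \prod_(i | P i) F i /\ (\prod_(i | P i) F i) `^ r = \prod_(i | P i) F i `^ r by [].
elim/big_rec2: _ => [|i x y _ [y0 IH]]; first by rewrite powR1.
by split; [rewrite mulr_ge0|rewrite powRM// IH].
Qed.

(** Raised to the power r, Horn's inequalities say that z_i^r is weakly log-majorized by x_i^r
    y_i^r. Writing the latter as (x_i^(r/(1-t)))^(1-t) (y_i^(r/t))^t prepares [gauge_holder]. *)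
Lemma norm_holder (X Y : 'M[C]_n) r t : 0 < r -> 0 < t < 1 ->
  N (mxpow ((X *m Y)^t* *m (X *m Y)) r) <=
  N (mxpow (X^t* *m X) (r / (1 - t))) `^ (1 - t) * N (mxpow (Y^t* *m Y) (r / t)) `^ t.
Proof.
move=> r0 t01; have /andP[t0 t1] := t01.
have t1' : 0 < 1 - t by rewrite subr_gt0.
have [Ux [x [UUx XE xdec]]] := hermitian_decreasing (gram_hermitian X).
have [Uy [y [UUy YE ydec]]] := hermitian_decreasing (gram_hermitian Y).
have [Uz [z [UUz ZE zdec]]] := hermitian_decreasing (gram_hermitian (X *m Y)).
have H := horn UUx UUy UUz xdec ydec zdec XE YE ZE.
have x0 := gram_udiag_ge0 UUx XE; have y0 := gram_udiag_ge0 UUy YE.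
have z0 := gram_udiag_ge0 UUz ZE.
rewrite ZE XE YE !norm_mxpow_udiag//.
apply: le_trans (gauge_holder gaugePhi t01 _ _); last 2 first.
- by move=> i; rewrite mxE powR_ge0.
- by move=> i; rewrite mxE powR_ge0.
apply: (gauge_log_majorization gaugePhi).
- by move=> i; rewrite mxE powR_ge0.
- by move=> i; rewrite mxE mulr_ge0 ?powR_ge0.
- by move=> i j ij; rewrite !mxE ge0_ler_powR ?nnegrE ?(ltW r0)// zdec.
move=> k; under eq_bigr do rewrite mxE.
under [leRHS]eq_bigr do rewrite !mxE -!powRrM !divfK ?gt_eqF// -powRM//.
rewrite -!powR_prod// => [|i]; last by rewrite mulr_ge0.
rewrite ge0_ler_powR ?(ltW r0)// ?nnegrE ?prodr_ge0// => [i _|].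
  by rewrite mulr_ge0.
by rewrite big_split.
Qed.

(** Letting every d_i^s grow by delta costs at most e; [g i] is the room this leaves for d_i, and
    eps is the least of these and 1. *)
Lemma gauge_continuous_powR (d : 'rV[R]_n) s e : 0 < s -> 0 < e -> (forall i, 0 <= d ord0 i) ->
  exists2 eps, 0 < eps &
    Phi (\row_i (d ord0 i + eps) `^ s) <= Phi (\row_i d ord0 i `^ s) + e.
Proof.
move=> s0 e0 d0.
pose delta := e / (Phi (const_mx 1) + 1).
have P1 : 0 < Phi (const_mx 1) + 1 by rewrite ltr_wpDl ?(gauge_ge0 gaugePhi).
have del0 : 0 < delta by rewrite divr_gt0.
pose g i := (d ord0 i `^ s + delta) `^ s^-1 - d ord0 i.
have ds i : d ord0 i = (d ord0 i `^ s) `^ s^-1.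
  by rewrite -powRrM mulfV ?gt_eqF// powRr1.
have g0 i : 0 < g i.
  rewrite subr_gt0 {1}ds gt0_ltr_powR ?invr_gt0// ?nnegrE ?powR_ge0 ?addr_ge0 ?powR_ge0 ?ltW//.
  by rewrite ltrDl.
pose eps := \big[Num.min/1]_i g i.
have eps0 : 0 < eps.
  by rewrite /eps; elim/big_ind: _ => // x y x0 y0; rewrite lt_min x0.
exists eps => //.
have -> : e = delta * (Phi (const_mx 1) + 1) by rewrite divfK ?gt_eqF.
apply: (@le_trans _ _ (Phi (\row_i d ord0 i `^ s + delta *: const_mx 1))).
  apply: (gauge_le gaugePhi) => i; rewrite !mxE mulr1 ger0_norm ?powR_ge0//.
  have -> : d ord0 i `^ s + delta = ((d ord0 i `^ s + delta) `^ s^-1) `^ s.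
    by rewrite -powRrM mulVf ?gt_eqF// powRr1// addr_ge0 ?powR_ge0// ltW.
  rewrite ge0_ler_powR ?(ltW s0)// ?nnegrE ?powR_ge0// ?addr_ge0 ?(ltW eps0)//.
  by rewrite addrC -lerBrDr; apply: bigmin_le_cond.
rewrite (le_trans (gaugeD gaugePhi _ _))// lerD2l (gaugeZ gaugePhi _ (ltW del0)).
by rewrite ler_pM2l// lerDl.
Qed.

End SymmetricNorm.

(** * Positive definite matrices and their real powers *)

Section PositiveDefinite.
Variables (R : realType) (n : nat).
Local Notation C := R[i].
Implicit Types (A P U : 'M[C]_n) (w : 'rV[R]_n).

(** The form of A at the i-th column of U^*, an eigenvector, equals the i-th eigenvalue. *)
Lemma posdef_spectrum A i : posdefmx A -> 0 < spectrum A ord0 i.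
Proof.
move=> [hA]; set U := spectralmx A; have UU : U \is unitarymx by exact: spectral_unitarymx.
move=> /(_ (col i (U^t*))).
have vE : (col i (U^t*))^t* = row i U.
  by apply/matrixP => j k; rewrite !mxE conjCK.
have rc (D V : 'M[C]_n) : (row i D *m col i V) ord0 ord0 = (D *m V) i i.
  by rewrite !mxE; apply: eq_bigr => k _; rewrite !mxE.
have -> : col i (U^t*) != 0.
  apply/eqP => v0; have := rc U (U^t*).
  rewrite v0 mulmx0 (unitarymxP UU) !mxE eqxx => /esym/eqP.
  by rewrite oner_eq0.
move=> /(_ isT); rewrite vE -row_mul rc {1}(spectrumP hA) udiag_conj//.
by rewrite !mxE eqxx mulr1n ltcR.
Qed.

Lemma posdef_congr P A : P \in unitmx -> posdefmx A -> posdefmx (P^t* *m A *m P).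
Proof.
move=> Pu [/hermsymmxP hA Apos]; split.
  by apply/hermsymmxP; rewrite !trmxC_mul trmxCK hA mulmxA.
move=> v v0; have := Apos (P *m v).
rewrite trmxC_mul !mulmxA; apply; apply: contra v0 => /eqP Pv0.
by rewrite -(mulKmx Pu v) Pv0 mulmx0.
Qed.

Lemma posdef_udiag U w : U \is unitarymx -> (forall i, 0 < w ord0 i) ->
  posdefmx (U^t* *m diagC w *m U).
Proof.
move=> UU w0; apply: posdef_congr; first exact: unitarymx_unit.
split; first by apply/hermsymmxP; rewrite diagC_trmxC.
move=> v /cV0Pn[i vi]; rewrite /diagC mul_mx_diag mxE (bigD1 i)//= ltr_pwDl//.
  rewrite !mxE mulrAC [_ * v i _]mulrC mulr_gt0 ?mul_conjC_gt0//.
  by rewrite ltcR.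
apply: sumr_ge0 => j _; rewrite !mxE mulrAC [_ * v j _]mulrC.
by rewrite mulr_ge0 ?mul_conjC_ge0// ler0c ltW.
Qed.

Lemma posdef1 : posdefmx (1%:M : 'M[C]_n).
Proof.
have U1 : (1%:M : 'M[C]_n) \is unitarymx.
  by apply/unitarymxP; rewrite mul1mx trmx1 map_mx1.
have := @posdef_udiag 1%:M (const_mx 1) U1; rewrite diagC1 !mulmx1 trmx1 map_mx1.
by apply => i; rewrite mxE.
Qed.

Lemma mxpow_trmxC A t : (mxpow A t)^t* = mxpow A t.
Proof. by rewrite mxpowE udiag_trmxC. Qed.

Lemma mxpowD A s t : posdefmx A -> mxpow A s *m mxpow A t = mxpow A (s + t).
Proof.
move=> pA; rewrite (mxpowE A s) (mxpowE A t) (mxpowE A (s + t)).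
rewrite (udiagM _ _ (spectral_unitarymx A)).
set x := \row_i _; set y := \row_i _; suff -> : x = y by [].
apply/rowP => i; rewrite !mxE powRD//; apply/implyP => _.
by have := posdef_spectrum i pA; rewrite mxE => /gt_eqF ->.
Qed.

Lemma mxpow0 A : mxpow A 0 = 1%:M.
Proof.
rewrite mxpowE.
have -> : \row_i spectrum A ord0 i `^ 0 = const_mx 1.
  by apply/rowP => i; rewrite !mxE powRr0.
by rewrite diagC1 mulmx1 -invmx_unitary ?spectral_unitarymx// mulVmx ?spectral_unit.
Qed.

Lemma mxpow1 A : posdefmx A -> mxpow A 1 = A.
Proof.
move=> pA; rewrite mxpowE [RHS]spectrumP; last by case: pA.
suff -> : \row_i spectrum A ord0 i `^ 1 = spectrum A by [].
apply/rowP => i.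
by rewrite [LHS]mxE powRr1// ltW// posdef_spectrum.
Qed.

Lemma mxpowN A t : posdefmx A -> mxpow A t *m mxpow A (- t) = 1%:M.
Proof. by move=> pA; rewrite mxpowD// subrr mxpow0. Qed.

Lemma mxpow_unit A t : posdefmx A -> mxpow A t \in unitmx.
Proof. by move=> pA; have [u _] := mulmx1_unit (mxpowN t pA); exact: u. Qed.

Lemma mxpowN1 A B : posdefmx A -> A *m B = 1%:M -> B = mxpow A (- 1).
Proof.
move=> pA AB; have := mxpowN 1 pA; rewrite mxpow1// -AB.
by have [uA _] := mulmx1_unit AB; move/(can_inj (mulKmx uA)) => ->.
Qed.

Lemma posdef_gram P : P \in unitmx -> posdefmx (P^t* *m P).
Proof. by move=> Pu; have := posdef_congr Pu posdef1; rewrite mulmx1. Qed.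

End PositiveDefinite.

(** * Norms of powers of positive definite and Gram matrices *)

Section NormOfPowers.
Variables (R : realType) (n : nat).
Local Notation C := R[i].
Variables (N : 'M[C]_n -> R) (Phi : 'rV[R]_n -> R).
Hypothesis gaugePhi : symmetric_gauge Phi.
Hypothesis NE : forall A, N A = Phi (singular_values A).
Implicit Types (A Y : 'M[C]_n).

Lemma norm_mxpow_spectrum A t : A \is hermsymmx ->
  N (mxpow A t) = Phi (\row_i (spectrum A ord0 i) `^ t).
Proof.
by move=> hA; rewrite {1}(spectrumP hA) (norm_mxpow_udiag gaugePhi NE) ?spectral_unitarymx.
Qed.

Lemma norm_mxpow_ge0 A t : 0 <= N (mxpow A t).
Proof. by rewrite NE (gauge_ge0 gaugePhi). Qed.

Lemma norm_mxpow_gt0 A t : posdefmx A -> 0 < N (mxpow A t).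
Proof.
move=> pA; rewrite norm_mxpow_spectrum; last by case: pA.
rewrite lt_neqAle (gauge_ge0 gaugePhi) andbT eq_sym; apply/eqP.
move=> /(gauge_eq0 gaugePhi)/rowP/(_ (Ordinal (gauge_dim_gt0 gaugePhi))).
by move/eqP; rewrite mxE [X in _ == X]mxE gt_eqF// powR_gt0// posdef_spectrum.
Qed.

(** Y intertwines Y^* Y with Y Y^*, so the two have the same eigenvalues. *)
Lemma norm_mxpow_gramC Y t : Y \in unitmx -> N (mxpow (Y^t* *m Y) t) = N (mxpow (Y *m Y^t*) t).
Proof.
move=> Yu; have := gram_hermitian (Y^t*); rewrite trmxCK => hY.
rewrite [RHS]norm_mxpow_spectrum//.
apply: (norm_mxpow gaugePhi NE); first exact: gram_hermitian.
rewrite (@char_poly_similar _ _ Y _ (Y *m Y^t*))// ?mulmxA//.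
by rewrite {1}(spectrumP hY) char_poly_udiag ?spectral_unitarymx.
Qed.

Lemma norm_mxpow_inv A t : posdefmx A -> N (mxpow (mxpow A (-1)) (- t)) = N (mxpow A t).
Proof.
move=> pA; rewrite [mxpow A (-1)]mxpowE (norm_mxpow_udiag gaugePhi NE) ?spectral_unitarymx//.
rewrite norm_mxpow_spectrum; last by case: pA.
by congr Phi; apply/rowP => i; rewrite !mxE -powRrM mulrNN mul1r.
Qed.

End NormOfPowers.

(** * The variational formulas *)

(** Raise the hypothesis to the power 1 - a and move y^(-a) to the other side. This turns a Hoelder
    bound on the left factor into one on the product form. *)
Lemma powR_holder_inv (R : realType) (x y z a : R) : 0 <= x -> 0 < y -> 0 <= z -> 0 < 1 - a ->
  x <= z `^ (1 - a)^-1 * y `^ (- a / (1 - a)) -> x `^ (1 - a) * y `^ a <= z.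
Proof.
move=> x0 y0 z0 a1 /(ge0_ler_powR (ltW a1)).
rewrite !nnegrE x0 mulr_ge0 ?powR_ge0// => /(_ isT isT).
rewrite powRM ?powR_ge0// -!powRrM mulVf ?gt_eqF// powRr1// divfK ?gt_eqF//.
by rewrite powRN -ler_pdivlMr ?powR_gt0// => /le_trans; apply.
Qed.

(** * Identities between Gram products *)

Section GramIdentities.
Variables (R : realType) (n : nat).
Local Notation C := R[i].
Implicit Types (a c d z w Q K V : 'M[C]_n).

Lemma gram3 a c K : a^t* = a -> c^t* = c ->
  (a *m K *m c)^t* *m (a *m K *m c) = c *m K^t* *m (a *m a) *m K *m c.
Proof. by move=> aC cC; rewrite !trmxC_mul aC cC !mulmxA. Qed.

Lemma gram2 a c : a^t* = a -> c^t* = c -> (a *m c)^t* *m (a *m c) = c *m (a *m a) *m c.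
Proof. by move=> aC cC; rewrite trmxC_mul aC cC !mulmxA. Qed.

Lemma mulmx_cancel_mid (a b c d : 'M[C]_n) : b *m c = 1%:M -> (a *m b) *m (c *m d) = a *m d.
Proof. by move=> bc; rewrite mulmxA -(mulmxA a) bc mulmx1. Qed.

Lemma sandwichK a c w : a *m c = 1%:M -> a *m (c *m w *m c) *m a = w.
Proof.
move=> ac; rewrite -mulmxA -(mulmxA (c *m w)) (mulmx1C ac) mulmx1.
by rewrite mulmxA ac mul1mx.
Qed.

Lemma sandwich_inv a c w z : a *m c = 1%:M -> w *m z = 1%:M ->
  (a *m w *m a) *m (c *m z *m c) = 1%:M.
Proof.
move=> ac wz; rewrite -(mulmxA c) (mulmx_cancel_mid _ _ ac).
by rewrite -(mulmxA a) (mulmxA w) wz mul1mx.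
Qed.

(** Shows that the Gram matrix of B^(-q/2) Z^(-1/2) is the inverse of the matrix in [right_term]. *)
Lemma gram2_inv a c d (e : 'M[C]_n) : a^t* = a -> c^t* = c -> d^t* = d -> e^t* = e ->
  a *m d = 1%:M -> c *m e = 1%:M ->
  (a *m c)^t* *m (a *m c) *m ((d *m e)^t* *m (d *m e)) = 1%:M.
Proof.
move=> aC cC dC eC ad ce; rewrite !gram2// -!mulmxA (mulmxA c e) ce mul1mx.
by rewrite (mulmxA a d) ad mul1mx (mulmxA a d) ad mul1mx.
Qed.

(** For c = B^(q/2), z = Z^(1/2) and z' = Z^(-1/2), conjugation by c z carries the matrix of
    [left_term] to T w with w = (c Z c)^-1. *)
Lemma gram_similar Q c w z z' : c^t* = c -> z'^t* = z' -> z *m z' = 1%:M ->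
    c *m w *m c *m z = z' ->
  (c *m z) *m ((Q *m z')^t* *m (Q *m z')) = (Q *m c)^t* *m (Q *m c) *m w *m (c *m z).
Proof.
move=> cC zC zz cwz; rewrite !trmxC_mul cC zC.
rewrite -!mulmxA (mulmxA z) zz mul1mx -cwz.
by rewrite !mulmxA.
Qed.

Lemma gram2C a c : a^t* = a -> c^t* = c -> (a *m c) *m (a *m c)^t* = (c *m a)^t* *m (c *m a).
Proof. by move=> aC cC; rewrite !trmxC_mul aC cC. Qed.

End GramIdentities.

(** * Hoelder bounds and near-optimal matrices *)

Section Variational.
Variables (R : realType) (n : nat).
Local Notation C := R[i].
Variables (N : 'M[C]_n -> R) (Phi : 'rV[R]_n -> R).
Hypothesis gaugePhi : symmetric_gauge Phi.
Hypothesis NE : forall A, N A = Phi (singular_values A).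
Variables (A B K : 'M[C]_n) (p q s : R).
Hypotheses (pA : posdefmx A) (pB : posdefmx B).

Let norm_holder_eq (X Y T L : 'M[C]_n) y r t : 0 < r -> 0 < t < 1 ->
    (X *m Y)^t* *m (X *m Y) = T -> X^t* *m X = L -> N (mxpow (Y^t* *m Y) (r / t)) = y ->
  N (mxpow T r) <= N (mxpow L (r / (1 - t))) `^ (1 - t) * y `^ t.
Proof. by move=> r0 t01 <- <- <-; apply: (norm_holder gaugePhi NE). Qed.

(** [T], [L Z] and [G Z] are the matrices inside the norms of [tPsi], [left_term] and [right_term],
    written as Gram matrices so that [norm_holder] applies. *)
Let Q := mxpow A (p / 2) *m K.
Let c := mxpow B (q / 2).
Let c' := mxpow B (- (q / 2)).
Let T := (Q *m c)^t* *m (Q *m c).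
Let L Z := (Q *m mxpow Z (- (1 / 2)))^t* *m (Q *m mxpow Z (- (1 / 2))).
Let G Z := (c *m mxpow Z (1 / 2))^t* *m (c *m mxpow Z (1 / 2)).

Let cC : c^t* = c. Proof. exact: mxpow_trmxC. Qed.
Let cC' : c'^t* = c'. Proof. exact: mxpow_trmxC. Qed.
Let cu : c \in unitmx. Proof. exact: mxpow_unit. Qed.
Let cN : c *m c' = 1%:M. Proof. exact: mxpowN. Qed.

Lemma tPsiE : tPsi N K p q s A B = N (mxpow T s).
Proof.
rewrite /tPsi /T /Q.
by rewrite (gram3 K (mxpow_trmxC A (p / 2)) cC) (mxpowD _ _ pA) -splitr.
Qed.

Lemma left_termE Z : left_term N K p q s A Z = N (mxpow (L Z) (s / (1 - s * q))).
Proof.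
rewrite /left_term /L /Q.
by rewrite (gram3 K (mxpow_trmxC A (p / 2)) (mxpow_trmxC Z _)) (mxpowD _ _ pA) -splitr.
Qed.

Lemma right_termE Z : right_term N q B Z = N (mxpow (G Z) (1 / q)).
Proof.
rewrite /right_term /G.
by rewrite (gram2 cC (mxpow_trmxC Z _)) (mxpowD _ _ pB) -splitr.
Qed.

Let posG Z : posdefmx Z -> posdefmx (G Z).
Proof. by move=> pZ; apply: posdef_gram; rewrite unitmx_mul cu mxpow_unit. Qed.

Lemma right_term_gt0 Z : posdefmx Z -> 0 < right_term N q B Z.
Proof. by move=> pZ; rewrite right_termE; apply: (norm_mxpow_gt0 gaugePhi NE _ (posG pZ)). Qed.

Lemma left_term_ge0 Z : 0 <= left_term N K p q s A Z.
Proof. exact: (norm_mxpow_ge0 gaugePhi NE). Qed.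

(** Hoelder with t = s q for Q B^(q/2) = (Q Z^(-1/2)) (Z^(1/2) B^(q/2)); the exponents become s/(1 -
    s q) and s/t = 1/q. *)
Lemma tPsi_le_prod Z : 0 < s -> 0 < q -> s * q < 1 -> posdefmx Z ->
  tPsi N K p q s A B <= prod_form N K p q s A B Z.
Proof.
move=> s0 q0 sq1 pZ; rewrite tPsiE /prod_form left_termE right_termE.
have sq01 : 0 < s * q < 1 by rewrite mulr_gt0.
have Yu : mxpow Z (1 / 2) *m c \in unitmx by rewrite unitmx_mul cu mxpow_unit.
apply: (@norm_holder_eq (Q *m mxpow Z (- (1 / 2))) (mxpow Z (1 / 2) *m c) T (L Z) _ _ _
  s0 sq01 _ erefl).
  by rewrite (mulmx_cancel_mid _ _ (mulmx1C (mxpowN (1 / 2) pZ))).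
have -> : s / (s * q) = 1 / q by field; rewrite !gt_eqF.
apply: etrans (norm_mxpow_gramC gaugePhi NE (1 / q) Yu) _.
by rewrite (gram2C (mxpow_trmxC Z (1 / 2)) cC).
Qed.

(** Hoelder for Q Z^(-1/2) = (Q B^(q/2)) (B^(-q/2) Z^(-1/2)) bounds the left factor; solving this
    inequality yields the product form. *)
Lemma prod_le_tPsi Z : 0 < s -> q < 0 -> posdefmx Z ->
  prod_form N K p q s A B Z <= tPsi N K p q s A B.
Proof.
move=> s0 q0 pZ; rewrite tPsiE /prod_form left_termE right_termE.
have sq0 : s * q < 0 by rewrite pmulr_rlt0.
have sq1 : 0 < 1 - s * q by rewrite subr_gt0 (lt_trans sq0).
have r0 : 0 < s / (1 - s * q) by rewrite divr_gt0.
(* With r = s/(1 - s q), this t makes r/(1 - t) = s and r/t = -1/q. *)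
pose t := - (s * q) / (1 - s * q).
have t1E : 1 - t = (1 - s * q)^-1 by rewrite /t; field; rewrite gt_eqF.
have t01 : 0 < t < 1.
  by rewrite divr_gt0 ?oppr_gt0//= -subr_gt0 t1E invr_gt0.
have GE := gram2_inv cC (mxpow_trmxC Z (1 / 2)) cC' (mxpow_trmxC Z (- (1 / 2))) cN
  (mxpowN (1 / 2) pZ).
have H : N (mxpow (L Z) (s / (1 - s * q))) <=
    N (mxpow T (s / (1 - s * q) / (1 - t))) `^ (1 - t) * N (mxpow (G Z) (1 / q)) `^ t.
  apply: (@norm_holder_eq (Q *m c) (c' *m mxpow Z (- (1 / 2))) (L Z) T _ _ _ r0 t01 _ erefl).
    by rewrite (mulmx_cancel_mid _ _ cN).
  rewrite (mxpowN1 (posG pZ) GE).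
  have -> : s / (1 - s * q) / t = - (1 / q).
    by rewrite /t; field; rewrite ?(lt_eqF q0) ?(gt_eqF s0) ?(gt_eqF sq1).
  exact: (norm_mxpow_inv gaugePhi NE (1 / q) (posG pZ)).
rewrite t1E invrK (divfK (lt0r_neq0 sq1)) in H.
apply: powR_holder_inv sq1 H; [exact: (norm_mxpow_ge0 gaugePhi NE)|
  exact: (norm_mxpow_gt0 gaugePhi NE _ (posG pZ))|exact: (norm_mxpow_ge0 gaugePhi NE)].
Qed.

(* Z = c^-1 W c^-1 with W = (T + eps)^(s q), where c = B^(q/2): the right factor
   is similar to W and the left one to T W^-1. *)
Lemma near_optimizer (U : 'M[C]_n) (tau : 'rV[R]_n) eps : q != 0 -> U \is unitarymx ->
    T = U^t* *m diagC tau *m U -> (forall i, 0 < tau ord0 i + eps) ->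
  exists Z, [/\ posdefmx Z,
    left_term N K p q s A Z =
      Phi (\row_i (tau ord0 i * (tau ord0 i + eps) `^ (- (s * q))) `^ (s / (1 - s * q)))
  & right_term N q B Z = Phi (\row_i (tau ord0 i + eps) `^ s)].
Proof.
move=> q0 UU TE te.
pose w a : 'rV[R]_n := \row_i (tau ord0 i + eps) `^ a.
pose W a := U^t* *m diagC (w a) *m U.
have posW a : posdefmx (W a).
  by apply: posdef_udiag => // i; rewrite mxE powR_gt0.
have WW a : W a *m W (- a) = 1%:M.
  rewrite /W (udiagM _ _ UU).
  have -> : \row_i (w a ord0 i * w (- a) ord0 i) = const_mx 1.
    apply/rowP => i; rewrite !mxE powRN mulfV// gt_eqF// powR_gt0//.
  by rewrite diagC1 mulmx1 -invmx_unitary// mulVmx ?unitarymx_unit.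
have cN' := mulmx1C cN.
pose Z := c' *m W (s * q) *m c'.
have pZ : posdefmx Z.
  by have := posdef_congr (mxpow_unit (- (q / 2)) pB) (posW (s * q)); rewrite cC'.
have ZN : Z *m (c *m W (- (s * q)) *m c) = 1%:M.
  exact: (sandwich_inv cN' (WW _)).
exists Z; split => //.
  rewrite left_termE.
  rewrite (norm_mxpow gaugePhi NE (d := \row_i (tau ord0 i * (tau ord0 i + eps) `^ (- (s * q))))).
  - by congr Phi; apply/rowP => i; rewrite !mxE.
  - exact: gram_hermitian.
  have TW : T *m W (- (s * q)) =
      U^t* *m diagC (\row_i (tau ord0 i * (tau ord0 i + eps) `^ (- (s * q)))) *m U.
    rewrite TE (udiagM _ _ UU).
    suff -> : \row_i (tau ord0 i * w (- (s * q)) ord0 i) =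
        \row_i (tau ord0 i * (tau ord0 i + eps) `^ (- (s * q))) by [].
    by apply/rowP => i; rewrite !mxE.
  rewrite -(char_poly_udiag _ UU) -TW.
  apply: (@char_poly_similar _ _ (c *m mxpow Z (1 / 2))).
    by rewrite unitmx_mul cu mxpow_unit.
  apply: (gram_similar _ cC (mxpow_trmxC Z _) (mxpowN _ pZ)).
  (* Since c W^-1 c = Z^-1, the required identity is Z^-1 Z^(1/2) = Z^(-1/2). *)
  rewrite (mxpowN1 pZ ZN) (mxpowD _ _ pZ); congr mxpow.
  by field.
have Yu : c *m mxpow Z (1 / 2) \in unitmx by rewrite unitmx_mul cu mxpow_unit.
have ZZ : mxpow Z (1 / 2) *m mxpow Z (1 / 2) = Z.
  by rewrite (mxpowD _ _ pZ) -splitr (mxpow1 pZ).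
(* In this order, opposite to that of [G Z], the product collapses to c Z c, whose eigenvalues are
   known. *)
have E : (c *m mxpow Z (1 / 2)) *m (c *m mxpow Z (1 / 2))^t* = W (s * q).
  rewrite (gram2C cC (mxpow_trmxC Z (1 / 2))) (gram2 (mxpow_trmxC Z (1 / 2)) cC).
  have WE M : M = Z -> c *m M *m c = W (s * q) by move=> ->; exact: (sandwichK (W (s * q)) cN).
  exact: WE ZZ.
rewrite right_termE; apply: etrans (norm_mxpow_gramC gaugePhi NE (1 / q) Yu) _.
rewrite E.
rewrite (norm_mxpow_udiag gaugePhi NE _ _ UU).
congr Phi; apply/rowP => i; rewrite !mxE -powRrM; congr (_ `^ _).
by field.
Qed.

End Variational.

(** * Reverse Young inequality and criteria for extrema *)

Lemma ler_wpowR2r (R : realType) (x y r : R) : 0 <= r -> 0 <= x -> x <= y -> x `^ r <= y `^ r.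
Proof.
by move=> r0 x0 xy; apply: (ge0_ler_powR r0) => //; rewrite nnegrE// (le_trans x0).
Qed.

(** Apply Young's inequality to x^(1-a) y^a and y with t = -a/(1-a): their weighted geometric mean
    is x. Then multiply by 1 - a > 0. *)
Lemma young_powR_reverse (R : realType) (x y a : R) : 0 <= x -> 0 < y -> a < 0 ->
  (1 - a) * x + a * y <= x `^ (1 - a) * y `^ a.
Proof.
move=> x0 y0 a0; have a1 : 0 < 1 - a by rewrite subr_gt0 (lt_trans a0).
pose u := x `^ (1 - a) * y `^ a; pose t := - a / (1 - a).
have t1E : 1 - t = (1 - a)^-1 by rewrite /t; field; rewrite gt_eqF.
have t01 : 0 < t < 1 by rewrite divr_gt0 ?oppr_gt0//= -subr_gt0 t1E invr_gt0.
have := @young_powR R t u y t01; rewrite mulr_ge0 ?powR_ge0// (ltW y0) => /(_ isT isT).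
have -> : u `^ (1 - t) * y `^ t = x.
  rewrite t1E powRM ?powR_ge0// -!powRrM mulfV ?gt_eqF// powRr1// -mulrA -powRD.
    have -> : a / (1 - a) + t = 0 by rewrite /t; field; rewrite gt_eqF.
    by rewrite powRr0 mulr1.
  by rewrite (gt_eqF y0) implybT.
rewrite -(ler_pM2l a1); set lhs := _ * x => H; rewrite -lerBrDr; apply: le_trans H _.
by rewrite le_eqVlt; apply/orP; left; apply/eqP; rewrite t1E /t /u; field; rewrite gt_eqF.
Qed.

Lemma min_over_posdefP (R : realType) n (K : 'M[R[i]]_n) (F : 'M[R[i]]_n -> R) m :
    (forall Z, posdefmx Z -> m <= F Z) ->
    (forall e, 0 < e -> exists2 Z, posdefmx Z & F Z <= m + e) ->
    (K \in unitmx -> exists2 Z, posdefmx Z & F Z <= m) ->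
  min_over_posdef K F m.
Proof.
move=> Fge Fle Fmin.
have lb : lbound [set F Z | Z in @posdefmx R n] m by move=> _ [Z pZ <-]; apply: Fge.
split; first split=> // u ulb.
  apply/ler_addgt0Pr => e /Fle[Z pZ]; apply: le_trans.
  by apply: ulb; exists Z.
move=> /Fmin[Z pZ FZ]; split => //; exists Z => //.
by apply/eqP; rewrite eq_le FZ Fge.
Qed.

Lemma max_over_posdefP (R : realType) n (K : 'M[R[i]]_n) (F : 'M[R[i]]_n -> R) m :
    (forall Z, posdefmx Z -> F Z <= m) ->
    (forall e, 0 < e -> exists2 Z, posdefmx Z & m - e <= F Z) ->
    (K \in unitmx -> exists2 Z, posdefmx Z & m <= F Z) ->
  max_over_posdef K F m.
Proof.
move=> Fle Fge Fmax.
have ub : ubound [set F Z | Z in @posdefmx R n] m by move=> _ [Z pZ <-]; apply: Fle.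
split; first split=> // u uub.
  apply/ler_addgt0Pr => e /Fge[Z pZ]; rewrite lerBlDr => /le_trans; apply.
  by rewrite lerD2r; apply: uub; exists Z.
move=> /Fmax[Z pZ FZ]; split => //; exists Z => //.
by apply/eqP; rewrite eq_le FZ Fle.
Qed.

(** * Optimizing matrices for a prescribed bound *)

Section Optimizers.
Variables (R : realType) (n : nat).
Local Notation C := R[i].
Variables (N : 'M[C]_n -> R) (Phi : 'rV[R]_n -> R).
Hypothesis gaugePhi : symmetric_gauge Phi.
Hypothesis NE : forall A, N A = Phi (singular_values A).
Variables (A B K : 'M[C]_n) (p q s : R).
Hypotheses (pA : posdefmx A) (pB : posdefmx B) (s0 : 0 < s) (q0 : q != 0) (sq1 : 0 < 1 - s * q).

(** The bound r covers two situations: r above [tPsi], met with T + eps for small eps > 0, and r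
    equal to [tPsi] for invertible K, where T > 0 allows eps = 0. *)
Lemma optimizers (r : R) : tPsi N K p q s A B < r \/ K \in unitmx /\ r = tPsi N K p q s A B ->
  exists Z, [/\ posdefmx Z, right_term N q B Z <= r,
    0 < q -> left_term N K p q s A Z <= r
  & q < 0 -> tPsi N K p q s A B <= left_term N K p q s A Z].
Proof.
pose X := mxpow A (p / 2) *m K *m mxpow B (q / 2).
have hT := gram_hermitian X.
set T := X^t* *m X in hT; pose tau := spectrum T; pose U := spectralmx T.
have UU : U \is unitarymx by apply: spectral_unitarymx.
have TE : T = U^t* *m diagC tau *m U := spectrumP hT.
have tau0 := gram_udiag_ge0 UU TE.
have FE : tPsi N K p q s A B = Phi (\row_i tau ord0 i `^ s).
  by rewrite (tPsiE N B K p q s pA) (norm_mxpow_spectrum gaugePhi NE _ hT).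
rewrite FE => rP.
have [eps [eps0 te epsr]] : exists eps, [/\ 0 <= eps, forall i, 0 < tau ord0 i + eps
    & Phi (\row_i (tau ord0 i + eps) `^ s) <= r].
  case: rP => [Fr|[Ku ->]].
    have [|eps eps0 epsr] := gauge_continuous_powR gaugePhi s0 _ tau0
      (e := r - Phi (\row_i tau ord0 i `^ s)).
      by rewrite subr_gt0.
    exists eps; split; first exact: ltW.
      by move=> i; rewrite ltr_wpDl.
    by rewrite addrC subrK in epsr.
  have pT : posdefmx T.
    apply: posdef_gram; rewrite 2!unitmx_mul Ku.
    by rewrite (mxpow_unit _ pA) (mxpow_unit _ pB).
  exists 0; split=> // [i|]; first by rewrite addr0; apply: posdef_spectrum.
  rewrite le_eqVlt; apply/orP; left; apply/eqP; congr Phi.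
  by apply/rowP => i; rewrite !mxE addr0.
have [Z [pZ ZL ZR]] := near_optimizer gaugePhi NE s pA pB q0 UU TE te.
exists Z; rewrite ZL ZR; split => // [q_gt0|q_lt0].
  apply: le_trans epsr; apply: (gauge_le gaugePhi) => i.
  rewrite [X in `|X| <= _]mxE [leRHS]mxE ger0_norm ?powR_ge0//.
  (* For q > 0, replacing the bare tau_i by tau_i + eps enlarges the base to (tau_i + eps)^(1 - s
     q). *)
  have -> : (tau ord0 i + eps) `^ s =
      ((tau ord0 i + eps) * (tau ord0 i + eps) `^ (- (s * q))) `^ (s / (1 - s * q)).
    have -> : (tau ord0 i + eps) * (tau ord0 i + eps) `^ (- (s * q)) =
        (tau ord0 i + eps) `^ (1 - s * q).
      by rewrite powRD ?(gt_eqF (te i)) ?implybT// powRr1// ltW.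
    by rewrite -powRrM mulrCA mulfV ?mulr1// gt_eqF.
  apply: ler_wpowR2r; first by rewrite divr_ge0// ltW.
    by rewrite mulr_ge0 ?powR_ge0.
  by rewrite ler_wpM2r ?powR_ge0// lerDl.
apply: (gauge_le gaugePhi) => i; rewrite [X in `|X| <= _]mxE [leRHS]mxE ger0_norm ?powR_ge0//.
(* For q < 0, dropping eps lowers the base to tau_i^(1 - s q). As tau_i may be zero, splitting that
   power rests on 1 - s q being nonzero. *)
have sq0 : 0 <= - (s * q) by rewrite oppr_ge0 pmulr_rle0// ltW.
have -> : tau ord0 i `^ s = (tau ord0 i * tau ord0 i `^ (- (s * q))) `^ (s / (1 - s * q)).
  have -> : tau ord0 i * tau ord0 i `^ (- (s * q)) = tau ord0 i `^ (1 - s * q).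
    rewrite powRD ?powRr1// gt_eqF//.
  by rewrite -powRrM mulrCA mulfV ?mulr1// gt_eqF.
apply: ler_wpowR2r; first by rewrite divr_ge0// ltW.
  by rewrite mulr_ge0 ?powR_ge0.
by rewrite ler_wpM2l// ler_wpowR2r// lerDl.
Qed.

End Optimizers.

(** * Assembly of the minimum and maximum formulas *)

Theorem theorem3p2 (R : realType) (n : nat) (N : 'M[R[i]]_n -> R)
    (A B K : 'M[R[i]]_n) (p q s : R)
    (hN : symmetric_norm N) (hA : posdefmx A) (hB : posdefmx B) :
  (0 < s -> 0 < q -> s < 1 / q ->
     min_over_posdef K (prod_form N K p q s A B) (tPsi N K p q s A B) /\
     min_over_posdef K (sum_form N K p q s A B) (tPsi N K p q s A B)) /\
  (0 < s -> q < 0 ->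
     max_over_posdef K (prod_form N K p q s A B) (tPsi N K p q s A B) /\
     max_over_posdef K (sum_form N K p q s A B) (tPsi N K p q s A B)).
Proof.
case: hN => _ [Phi [gaugePhi NE]].
have left0 Z := left_term_ge0 gaugePhi NE A K p q s Z.
have right0 Z := right_term_gt0 gaugePhi NE q hB (Z := Z).
split=> [s0 q0 sq|s0 q0].
  have sq1 : s * q < 1 by rewrite -ltr_pdivlMr.
  have sq1' : 0 < 1 - s * q by rewrite subr_gt0.
  have sq0 : 0 < s * q by rewrite mulr_gt0.
  have qn0 : q != 0 by rewrite gt_eqF.
  (* Since Young's inequality orders the two forms, a lower bound for the product form and
     near-minimizers of the sum form settle both. *)
  have prod_sum Z : posdefmx Z -> prod_form N K p q s A B Z <= sum_form N K p q s A B Z.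
    by move=> pZ; apply: young_powR; rewrite ?sq0//; apply/ltW/right0.
  have lower Z : posdefmx Z -> tPsi N K p q s A B <= prod_form N K p q s A B Z.
    by move=> pZ; exact: (tPsi_le_prod gaugePhi NE K p hA hB s0 q0 sq1 pZ).
  have upper r : tPsi N K p q s A B < r \/ K \in unitmx /\ r = tPsi N K p q s A B ->
      exists2 Z, posdefmx Z & sum_form N K p q s A B Z <= r.
    move=> /(optimizers gaugePhi NE hA hB s0 qn0 sq1')[Z [pZ Zr Zl _]]; exists Z => //.
    rewrite /sum_form; apply: le_trans (_ : (1 - s * q) * r + s * q * r <= _); last first.
      by rewrite -mulrDl subrK mul1r.
    by apply: lerD; [rewrite (ler_pM2l sq1'); exact: Zl|rewrite (ler_pM2l sq0)].
  have upperS e : 0 < e -> exists2 Z, posdefmx Z &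
      sum_form N K p q s A B Z <= tPsi N K p q s A B + e.
    by move=> e0; apply: upper; left; rewrite ltrDl.
  have upperK : K \in unitmx -> exists2 Z, posdefmx Z &
      sum_form N K p q s A B Z <= tPsi N K p q s A B.
    by move=> Ku; apply: upper; right.
  split; apply: min_over_posdefP.
  - exact: lower.
  - by move=> e /upperS[Z pZ ZF]; exists Z => //; apply: le_trans (prod_sum _ pZ) ZF.
  - by move=> /upperK[Z pZ ZF]; exists Z => //; apply: le_trans (prod_sum _ pZ) ZF.
  - by move=> Z pZ; apply: le_trans (lower _ pZ) (prod_sum _ pZ).
  - exact: upperS.
  - exact: upperK.
have sq0 : s * q < 0 by rewrite pmulr_rlt0.
have sq1 : 0 < 1 - s * q by rewrite subr_gt0 (lt_trans sq0).
have qn0 : q != 0 by rewrite lt_eqF.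
(* For q < 0 the order of the forms is reversed, so the product form needs the upper bound and the
   sum form the near-maximizers. *)
have sum_prod Z : posdefmx Z -> sum_form N K p q s A B Z <= prod_form N K p q s A B Z.
  by move=> pZ; apply: young_powR_reverse => //; apply: right0.
have upper Z : posdefmx Z -> prod_form N K p q s A B Z <= tPsi N K p q s A B.
  by move=> pZ; exact: (prod_le_tPsi gaugePhi NE K p hA hB s0 q0 pZ).
have lower e : 0 < e \/ K \in unitmx /\ e = 0 ->
    exists2 Z, posdefmx Z &
    tPsi N K p q s A B - e <= sum_form N K p q s A B Z.
  (* The excess of r over [tPsi] is scaled so that the negative weight s q turns it into a loss of
     exactly e. *)
  move=> eP; pose r := tPsi N K p q s A B + e / - (s * q).
  have [|Z [pZ Zr _ Zl]] := @optimizers _ _ N Phi gaugePhi NE A B K p q s hA hB s0 qn0 sq1 r.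
    case: eP => [e0|[Ku e0]]; [left|right]; last by rewrite /r e0 mul0r addr0.
    by rewrite ltrDl divr_gt0// oppr_gt0.
  exists Z => //; rewrite /sum_form.
  apply: le_trans (_ : (1 - s * q) * tPsi N K p q s A B + s * q * r <= _).
    rewrite le_eqVlt; apply/orP; left; apply/eqP; rewrite /r.
    by move: (tPsi _ _ _ _ _ _ _) => F; field; rewrite ?(gt_eqF s0) ?(lt_eqF q0).
  by apply: lerD; [rewrite (ler_pM2l sq1); exact: Zl|rewrite (ler_nM2l sq0)].
have lowerS e : 0 < e -> exists2 Z, posdefmx Z &
    tPsi N K p q s A B - e <= sum_form N K p q s A B Z.
  by move=> e0; apply: lower; left.
have lowerK : K \in unitmx -> exists2 Z, posdefmx Z &
    tPsi N K p q s A B <= sum_form N K p q s A B Z.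
  by move=> Ku; rewrite -[tPsi _ _ _ _ _ _ _]subr0; apply: lower; right.
split; apply: max_over_posdefP.
- exact: upper.
- by move=> e /lowerS[Z pZ ZF]; exists Z => //; apply: le_trans ZF (sum_prod _ pZ).
- by move=> /lowerK[Z pZ ZF]; exists Z => //; apply: le_trans ZF (sum_prod _ pZ).
- by move=> Z pZ; apply: le_trans (sum_prod _ pZ) (upper _ pZ).
- exact: lowerS.
- exact: lowerK.
Qed.
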